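(* Let $\mathbb A$ be a distributive monoidal category and consider the category $\mathbf H\,\ulcorner\mathbb A\urcorner^{*}$ of horizontal cells of its free cornering with iteration. (i) The functor $(-)^\times:\mathbf H\,\ulcorner\mathbb A\urcorner^{*}\to\mathbf H\,\ulcorner\mathbb A\urcorner^{*}$ is a comonad with counit $\varepsilon^\times:(-)^\times\to 1$ given by components $\varepsilon^\times_U=\pi_1\mid\frac{id_U}{\pi_0}:(U^\times;I;I;U)$ and comultiplication $\delta^\times:(-)^\times\to(-)^{\times\times}$ given by components $\delta^\times_U=(id_{U^\times})^\times_{\pi_0,\Delta^\times_U}:(U^\times;I;I;U^{\times\times})$. (ii) The functor $(-)^+:\mathbf H\,\ulcorner\mathbb A\urcorner^{*}\to\mathbf H\,\ulcorner\mathbb A\urcorner^{*}$ is a monad with unit $\eta^+:1\to(-)^+$ given by components $\eta^+_U=\frac{id_U}{\iota_0}\mid\iota_1:(U;I;I;U^+)$ and multiplication $\mu^+:(-)^{++}\to(-)^+$ given by components $\mu^+_U=(id_{U^+})^+_{\iota_0,\nabla^+_U}:(U^{++};I;I;U^+)$.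
   Context: Monoidal categories are strict, and composites are in diagrammatic order ($fg$ is first $f$, then $g$). A single-object double category $\mathbb D$ has a horizontal edge monoid $(\mathbb D_H,\otimes,I)$, a vertical edge monoid $(\mathbb D_V,\otimes,I)$, and for $A,B\in\mathbb D_H$, $U,W\in\mathbb D_V$ a set of cells $(U;A;B;W)$ (left; top; bottom; right boundary). For $\alpha:(U;A;B;V)$ and $\beta:(V;A';B';W)$ there is a horizontal composite $\alpha\mid\beta:(U;A\otimes A';B\otimes B';W)$; for $\alpha:(U;A;C;W)$ and $\beta:(U';C;B;W')$ a vertical composite $\frac{\alpha}{\beta}:(U\otimes U';A;B;W\otimes W')$. Both are associative and unital, with horizontal units $id_U:(U;I;I;U)$ and vertical units $1_A:(I;A;A;I)$, where $id_I=1_I$, $1_{A\otimes B}=1_A\mid 1_B$, $id_{U\otimes W}=\frac{id_U}{id_W}$, and interchange $\frac{\alpha}{\beta}\mid\frac{\gamma}{\delta}=\frac{\alpha\mid\gamma}{\beta\mid\delta}$ holds. $\mathbf H\,\mathbb D$ is the monoidal category with objects the elements of $\mathbb D_V$, morphisms $U\to W$ the cells $(U;I;I;W)$, composition $\mid$, and tensor given by vertical composition. A distributive monoidal category $(\mathbb A,\otimes,\oplus,I)$ is a symmetric monoidal category with binary coproducts $A\oplus B$ (injections $\sigma_0,\sigma_1$, copairing $[f,g]$; no initial object required) such that $[\sigma_0\otimes 1_C,\sigma_1\otimes 1_C]:(A\otimes C)\oplus(B\otimes C)\to(A\oplus B)\otimes C$ is invertible for all $A,B,C$. Exchanges with iteration: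 $\mathbb A^{\circ\bullet}_*$ is the monoid (operation $\otimes$, unit $I$) with elements generated by $A^\circ$, $A^\bullet$ ($A\in\mathbb A_0$), $I$, $U\otimes W$, $U\times W$, $U+W$, $U^\times$, $U^+$, subject to associativity and unitality of $\otimes$ and the equations $U^\times=I\times(U\otimes U^\times)$, $U^+=I+(U\otimes U^+)$. Free cornering with iteration: $\ulcorner\mathbb A\urcorner^{*}$ is the free single-object double category with horizontal edge monoid $(\mathbb A_0,\otimes,I)$, vertical edge monoid $\mathbb A^{\circ\bullet}_*$, and generating cells and equations: (1) for each $f:A\to B$ in $\mathbb A$ a cell $\ulcorner f\urcorner:(I;A;B;I)$ (also written $f$), with $\ulcorner fg\urcorner=\frac{\ulcorner f\urcorner}{\ulcorner g\urcorner}$, $\ulcorner 1_A\urcorner=1_A$, $\ulcorner f\otimes g\urcorner=\ulcorner f\urcorner\mid\ulcorner g\urcorner$; (2) for each $A\in\mathbb A_0$ corner cells $\mathsf{get}_L^A:(A^\circ;I;A;I)$, $\mathsf{put}_R^A:(I;A;I;A^\circ)$, $\mathsf{get}_R^A:(I;I;A;A^\bullet)$, $\mathsf{put}_L^A:(A^\bullet;A;I;I)$ with $\mathsf{put}_R^A\mid\mathsf{get}_L^A=1_A$, $\frac{\mathsf{get}_L^A}{\mathsf{put}_R^A}=id_{A^\circ}$, $\mathsf{get}_R^A\mid\mathsf{put}_L^A=1_A$, $\frac{\mathsf{get}_R^A}{\mathsf{put}_L^A}=id_{A^\bullet}$; (3) for all $U,W$, cells $\pi_0:(U\times W;I;I;U)$,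 $\pi_1:(U\times W;I;I;W)$, and for $\alpha:(V;A;B;U)$, $\beta:(V;A;B;W)$ a unique cell $\alpha\times\beta:(V;A;B;U\times W)$ with $(\alpha\times\beta)\mid\pi_0=\alpha$, $(\alpha\times\beta)\mid\pi_1=\beta$; (4) for all $U,W$, cells $\iota_0:(U;I;I;U+W)$, $\iota_1:(W;I;I;U+W)$, and for $\alpha:(U;A;B;V)$, $\beta:(W;A;B;V)$ a unique cell $\alpha+\beta:(U+W;A;B;V)$ with $\iota_0\mid(\alpha+\beta)=\alpha$, $\iota_1\mid(\alpha+\beta)=\beta$; (5) for $\alpha:(U;A;C;W)$, $\beta:(U;B;C;W)$ a unique cell $[\alpha,\beta]:(U;A\oplus B;C;W)$ with $\frac{\ulcorner\sigma_0\urcorner}{[\alpha,\beta]}=\alpha$, $\frac{\ulcorner\sigma_1\urcorner}{[\alpha,\beta]}=\beta$; (6) for $\alpha:(V;A;A;U)$, $f:(W;A;B;K)$, $g:(W;I;I;V\otimes W)$ a unique cell $\alpha^\times_{f,g}:(W;A;B;U^\times\otimes K)$ with $\alpha^\times_{f,g}\mid\frac{\pi_0}{id_K}=f$ and $\alpha^\times_{f,g}\mid\frac{\pi_1}{id_K}=g\mid\frac{\alpha}{\alpha^\times_{f,g}}$; (7) for $\alpha:(U;A;A;V)$, $f:(K;A;B;W)$, $g:(V\otimes W;I;I;W)$ a unique cell $\alpha^+_{f,g}:(U^+\otimes K;A;B;W)$ with $\frac{\iota_0}{id_K}\mid\alpha^+_{f,g}=f$ and $\frac{\iota_1}{id_K}\mid\alpha^+_{f,g}=\frac{\alpha}{\alpha^+_{f,g}}\mid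 g$. Here $\pi_0:U^\times\to I$, $\pi_1:U^\times\to U\otimes U^\times$, $\iota_0:I\to U^+$, $\iota_1:U\otimes U^+\to U^+$ are the projections/injections of $U^\times=I\times(U\otimes U^\times)$ and $U^+=I+(U\otimes U^+)$. For $\alpha:(U;A;A;W)$ put $\alpha^\times=\alpha^\times_{(\pi_0\mid 1_A),\pi_1}:(U^\times;A;A;W^\times)$ and $\alpha^+=\alpha^+_{(1_A\mid\iota_0),\iota_1}:(U^+;A;A;W^+)$; for $A=I$ these give the action on morphisms of the functors $(-)^\times$ and $(-)^+$ on $\mathbf H\,\ulcorner\mathbb A\urcorner^{*}$. Further, $\Delta^\times_U=(id_U)^\times_{id_{U^\times},\pi_1}:U^\times\to U^\times\otimes U^\times$ and $\nabla^+_U=(id_U)^+_{id_{U^+},\iota_1}:U^+\otimes U^+\to U^+$. *)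

(* Defs.v *)
(* All composites are in diagrammatic order. *)
From mathcomp Require Import all_boot generic_quotient.
From mathcomp Require Import boolp.

Set Implicit Arguments.
Unset Strict Implicit.
Unset Printing Implicit Defensive.

Local Open Scope quotient_scope.

Section Quot.
Variables (T : Type) (e : T -> T -> Prop).
Hypotheses (er : forall x, e x x) (es : forall x y, e x y -> e y x).
Hypothesis et : forall x y z, e x y -> e y z -> e x z.

Let b : rel {classic T} := fun x y => `[< e x y >].

Fact quot_refl : reflexive b.
Proof. by move=> x; apply/asboolP. Qed.
Fact quot_sym : symmetric b.
Proof. by move=> x y; apply/asboolP/asboolP; apply: es. Qed.
Fact quot_trans : transitive b.
Proof. by move=> y x z /asboolP h /asboolP k; apply/asboolP/(et h). Qed.

Definition quot_rel := EquivRel b quot_refl quot_sym quot_trans.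
Definition quot : Type := {eq_quot quot_rel}.
Definition quot_class (x : T) : quot := (\pi_{eq_quot quot_rel} x)%qT.
Definition quot_repr (c : quot) : T := repr (c : {eq_quot quot_rel}).

Lemma quot_reprK c : quot_class (quot_repr c) = c.
Proof. exact: reprK. Qed.

Lemma quot_classP x y : quot_class x = quot_class y <-> e x y.
Proof.
split=> [h|h].
  have /eqquotP : (x = y %[mod {eq_quot quot_rel}])%qT by [].
  by move/asboolP.
suff: (x = y %[mod {eq_quot quot_rel}])%qT by [].
by apply/eqquotP/asboolP.
Qed.

Lemma quot_repr_class x : e (quot_repr (quot_class x)) x.
Proof. by apply/quot_classP; rewrite quot_reprK. Qed.
End Quot.

Record category := Category {
  ob :> Type;
  hom : ob -> ob -> Type;
  idm : forall a, hom a a;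
  comp : forall x y z, hom x y -> hom y z -> hom x z;
  comp_idl : forall a b (f : hom a b), comp (idm a) f = f;
  comp_idr : forall a b (f : hom a b), comp f (idm b) = f;
  comp_assoc : forall a b c d (f : hom a b) (g : hom b c) (h : hom c d),
    comp f (comp g h) = comp (comp f g) h }.

Arguments hom {_} _ _.
Arguments idm {_} _.
Arguments comp {_ _ _ _} _ _.
Notation "f ;; g" := (comp f g) (at level 40, left associativity).

Definition is_functor (C D : category) (F : C -> D)
    (Fm : forall a b : C, hom a b -> hom (F a) (F b)) : Prop :=
  (forall a, Fm a a (idm a) = idm (F a)) /\
  (forall a b c (f : hom a b) (g : hom b c),
     Fm a c (f ;; g) = Fm a b f ;; Fm b c g).

Definition is_natural (C D : category)
    (F : C -> D) (Fm : forall a b : C, hom a b -> hom (F a) (F b))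
    (G : C -> D) (Gm : forall a b : C, hom a b -> hom (G a) (G b))
    (t : forall a, hom (F a) (G a)) : Prop :=
  forall a b (f : hom a b), Fm a b f ;; t b = t a ;; Gm a b f.

Record is_comonad (C : category) (T : C -> C)
    (Tm : forall a b : C, hom a b -> hom (T a) (T b))
    (eps : forall a, hom (T a) a) (delta : forall a, hom (T a) (T (T a)))
    : Prop := IsComonad {
  comonad_functor : is_functor Tm;
  counit_natural : is_natural Tm (fun a b f => f) eps;
  comult_natural : is_natural Tm (fun a b f => Tm _ _ (Tm a b f)) delta;
  comult_counitl : forall a, delta a ;; eps (T a) = idm (T a);
  comult_counitr : forall a, delta a ;; Tm _ _ (eps a) = idm (T a);
  comult_coassoc : forall a,
    delta a ;; delta (T a) = delta a ;; Tm _ _ (delta a) }.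

Record is_monad (C : category) (T : C -> C)
    (Tm : forall a b : C, hom a b -> hom (T a) (T b))
    (eta : forall a, hom a (T a)) (mu : forall a, hom (T (T a)) (T a))
    : Prop := IsMonad {
  monad_functor : is_functor Tm;
  unit_natural : is_natural (fun a b f => f) Tm eta;
  mult_natural : is_natural (fun a b f => Tm _ _ (Tm a b f)) Tm mu;
  mult_unitl : forall a, eta (T a) ;; mu a = idm (T a);
  mult_unitr : forall a, Tm _ _ (eta a) ;; mu a = idm (T a);
  mult_assoc : forall a, mu (T a) ;; mu a = Tm _ _ (mu a) ;; mu a }.

Record monoid := Monoid {
  mcar :> Type;
  mop : mcar -> mcar -> mcar;
  mun : mcar;
  mopA : forall x y z, mop x (mop y z) = mop (mop x y) z;
  mop1l : forall x, mop mun x = x;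
  mop1r : forall x, mop x mun = x }.

Arguments mun {m}.
Notation "x ** y" := (mop x y) (at level 40, left associativity).

(* Equality of morphisms whose sources and targets are only provably equal,
   as needed to express strictness; [hom_eq f g] entails that they are. *)
Variant hom_eq (C : category) (a b : C) (f : hom a b) :
  forall a' b' : C, hom a' b' -> Prop := HomEq : hom_eq f f.

Definition hom_cast (C : category) (a b a' b' : C)
    (ea : a = a') (eb : b = b') (f : hom a b) : hom a' b' :=
  ecast x (hom x b') ea (ecast y (hom a y) eb f).

Record strictMonCat := StrictMonCat {
  smc_cat :> category;
  ten : smc_cat -> smc_cat -> smc_cat;
  tenun : smc_cat;
  tenA : forall a b c, ten a (ten b c) = ten (ten a b) c;
  ten1l : forall a, ten tenun a = a;
  ten1r : forall a, ten a tenun = a;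
  tenm : forall a b a' b' : smc_cat,
    hom a b -> hom a' b' -> hom (ten a a') (ten b b');
  tenm_id : forall a a' : smc_cat, tenm (idm a) (idm a') = idm (ten a a');
  tenm_comp : forall (a b c a' b' c' : smc_cat)
    (f : hom a b) (g : hom b c) (f' : hom a' b') (g' : hom b' c'),
    tenm (f ;; g) (f' ;; g') = tenm f f' ;; tenm g g';
  tenmA : forall (a a' b b' c c' : smc_cat)
    (f : hom a a') (g : hom b b') (h : hom c c'),
    hom_eq (tenm f (tenm g h)) (tenm (tenm f g) h);
  tenm1l : forall (a b : smc_cat) (f : hom a b), hom_eq (tenm (idm tenun) f) f;
  tenm1r : forall (a b : smc_cat) (f : hom a b), hom_eq (tenm f (idm tenun)) f }.

Definition ob_monoid (A : strictMonCat) : monoid :=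
  Monoid (@tenA A) (@ten1l A) (@ten1r A).

Definition is_iso (C : category) (a b : C) (f : hom a b) : Prop :=
  exists g : hom b a, f ;; g = idm a /\ g ;; f = idm b.

(* [br_hex] is the hexagon, whose associativity isomorphisms are identities. *)
Record symStrictMonCat := SymStrictMonCat {
  ssmc_smc :> strictMonCat;
  br : forall a b : ssmc_smc, hom (ten a b) (ten b a);
  br_natural : forall (a a' b b' : ssmc_smc) (f : hom a a') (g : hom b b'),
    tenm f g ;; br a' b' = br a b ;; tenm g f;
  br_inv : forall a b : ssmc_smc, br a b ;; br b a = idm (ten a b);
  br_hex : forall a b c : ssmc_smc,
    hom_eq (br a (ten b c))
      (tenm (br a b) (idm c) ;;
       hom_cast (tenA b a c) erefl (tenm (idm b) (br a c))) }.

Record distMonCat := DistMonCat {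
  dmc_ssmc :> symStrictMonCat;
  oplus : dmc_ssmc -> dmc_ssmc -> dmc_ssmc;
  inj0 : forall a b : dmc_ssmc, hom a (oplus a b);
  inj1 : forall a b : dmc_ssmc, hom b (oplus a b);
  copair : forall a b c : dmc_ssmc, hom a c -> hom b c -> hom (oplus a b) c;
  copair_inj0 : forall (a b c : dmc_ssmc) (f : hom a c) (g : hom b c),
    inj0 a b ;; copair f g = f;
  copair_inj1 : forall (a b c : dmc_ssmc) (f : hom a c) (g : hom b c),
    inj1 a b ;; copair f g = g;
  copair_uniq : forall (a b c : dmc_ssmc) (f : hom a c) (g : hom b c)
    (h : hom (oplus a b) c),
    inj0 a b ;; h = f -> inj1 a b ;; h = g -> h = copair f g;
  distr_iso : forall a b c : dmc_ssmc,
    is_iso (copair (tenm (inj0 a b) (idm c)) (tenm (inj1 a b) (idm c))) }.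

(* As [hom_eq] and [hom_cast], for cells. *)
Section Boundaries.
Variables (V H : Type) (F : V -> H -> H -> V -> Type).

Variant cell_eq U A B W (c : F U A B W) :
  forall U' A' B' W', F U' A' B' W' -> Prop := CellEq : cell_eq c c.

Definition cell_cast U A B W U' A' B' W' (eU : U = U') (eA : A = A')
    (eB : B = B') (eW : W = W') (c : F U A B W) : F U' A' B' W' :=
  ecast x (F x A' B' W') eU (ecast x (F U x B' W') eA
    (ecast x (F U A x W') eB (ecast x (F U A B x) eW c))).

Lemma cell_cast_eq U A B W U' A' B' W' (eU : U = U') (eA : A = A')
    (eB : B = B') (eW : W = W') (c : F U A B W) :
  cell_eq (cell_cast eU eA eB eW c) c.
Proof. by case: U' / eU; case: A' / eA; case: B' / eB; case: W' / eW. Qed.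

Lemma cell_eq_sym U A B W (c : F U A B W) U' A' B' W' (d : F U' A' B' W') :
  cell_eq c d -> cell_eq d c.
Proof. by case. Qed.

Lemma cell_eq_trans U A B W (c : F U A B W) U' A' B' W' (d : F U' A' B' W')
    U2 A2 B2 W2 (e : F U2 A2 B2 W2) :
  cell_eq c d -> cell_eq d e -> cell_eq c e.
Proof. by case. Qed.

Lemma cell_eq_boundary U A B W (c : F U A B W) U' A' B' W'
    (d : F U' A' B' W') : cell_eq c d -> [/\ U = U', A = A', B = B' & W = W'].
Proof. by case. Qed.

Lemma cell_eq_eq U A B W (c d : F U A B W) : cell_eq c d -> c = d.
Proof.
move=> h; pose P U' A' B' W' (d' : F U' A' B' W') :=
  forall eU eA eB eW, cell_cast (eU : U' = U) (eA : A' = A)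
     (eB : B' = B) (eW : W' = W) d' = c.
have: P _ _ _ _ d.
  case: h => eU eA eB eW.
  by rewrite (Prop_irrelevance eU erefl) (Prop_irrelevance eA erefl)
    (Prop_irrelevance eB erefl) (Prop_irrelevance eW erefl).
by move/(_ erefl erefl erefl erefl) => /= ->.
Qed.
End Boundaries.

Notation "c =~ d" := (cell_eq c d) (at level 70).

(* [cell U A B W]: left, top, bottom and right boundary. *)
Record doubleCat := DoubleCat {
  dH : monoid;
  dV : monoid;
  cell : dV -> dH -> dH -> dV -> Type;
  hcomp : forall U A B V A' B' W,
    cell U A B V -> cell V A' B' W -> cell U (A ** A') (B ** B') W;
  vcomp : forall U A C W U' B W',
    cell U A C W -> cell U' C B W' -> cell (U ** U') A B (W ** W');
  hid : forall U, cell U mun mun U;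
  vid : forall A, cell mun A A mun;
  hcompA : forall U A B V A' B' W A'' B'' X
    (a : cell U A B V) (b : cell V A' B' W) (c : cell W A'' B'' X),
    hcomp a (hcomp b c) =~ hcomp (hcomp a b) c;
  hcomp_idl : forall U A B W (a : cell U A B W), hcomp (hid U) a =~ a;
  hcomp_idr : forall U A B W (a : cell U A B W), hcomp a (hid W) =~ a;
  vcompA : forall U A B W U' C W' U'' D W''
    (a : cell U A B W) (b : cell U' B C W') (c : cell U'' C D W''),
    vcomp a (vcomp b c) =~ vcomp (vcomp a b) c;
  vcomp_idl : forall U A B W (a : cell U A B W), vcomp (vid A) a =~ a;
  vcomp_idr : forall U A B W (a : cell U A B W), vcomp a (vid B) =~ a;
  hid_vid : hid mun = vid mun;
  vid_op : forall A B, vid (A ** B) = hcomp (vid A) (vid B);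
  hid_op : forall U W, hid (U ** W) = vcomp (hid U) (hid W);
  interchange : forall U A C W U' B W' A' C' X B' X'
    (a : cell U A C W) (b : cell U' C B W')
    (c : cell W A' C' X) (d : cell W' C' B' X'),
    hcomp (vcomp a b) (vcomp c d) = vcomp (hcomp a c) (hcomp b d) }.

Arguments cell {_} _ _ _ _.
Arguments hcomp {_ _ _ _ _ _ _ _} _ _.
Arguments vcomp {_ _ _ _ _ _ _ _} _ _.
Arguments hid {_} _.
Arguments vid {_} _.
Notation "a <|> b" := (hcomp a b) (at level 48, left associativity).
Notation "a </> b" := (vcomp a b) (at level 47, left associativity).

Section HorizontalCategory.
Variable D : doubleCat.
Implicit Types U V W X : dV D.

Lemma hcomp_cell_eq U A B V (a : cell U A B V) U2 A2 B2 V2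
    (a2 : cell U2 A2 B2 V2) A' B' W (b : cell V A' B' W)
    A2' B2' W2 (b2 : @cell D V2 A2' B2' W2) :
  a =~ a2 -> b =~ b2 -> a <|> b =~ a2 <|> b2.
Proof.
move=> h k; move: a2 h; case: k => a2 h.
have [eU eA eB _] := cell_eq_boundary h; subst.
by rewrite (cell_eq_eq h).
Qed.

Definition Hcomp U V W (a : cell U mun mun V) (b : cell V mun mun W) :
    cell U mun mun W :=
  cell_cast erefl (mop1l _) (mop1l _) erefl (a <|> b).

Fact Hcomp_idl U W (a : cell U mun mun W) : Hcomp (hid U) a = a.
Proof.
by apply: cell_eq_eq; apply: cell_eq_trans (cell_cast_eq _ _ _ _ _) _;
  apply: hcomp_idl.
Qed.

Fact Hcomp_idr U W (a : cell U mun mun W) : Hcomp a (hid W) = a.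
Proof.
by apply: cell_eq_eq; apply: cell_eq_trans (cell_cast_eq _ _ _ _ _) _;
  apply: hcomp_idr.
Qed.

Fact Hcomp_assoc U V W X (a : cell U mun mun V) (b : cell V mun mun W)
    (c : cell W mun mun X) : Hcomp a (Hcomp b c) = Hcomp (Hcomp a b) c.
Proof.
apply: cell_eq_eq; apply: cell_eq_trans (cell_cast_eq _ _ _ _ _) _.
apply: (@cell_eq_trans _ _ _ _ _ _ _ _ _ _ _ _ (a <|> (b <|> c))).
  by apply: hcomp_cell_eq; [exact: CellEq | exact: cell_cast_eq].
apply: (cell_eq_trans (hcompA _ _ _)); apply: cell_eq_sym.
apply: cell_eq_trans (cell_cast_eq _ _ _ _ _) _.
by apply: hcomp_cell_eq; [exact: cell_cast_eq | exact: CellEq].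
Qed.

Definition Hcat : category := Category Hcomp_idl Hcomp_idr Hcomp_assoc.
End HorizontalCategory.

Section Exchanges.
Variable A0 : Type.

Inductive exch_term :=
  | Tout of A0                            (* A° *)
  | Tin of A0                             (* A• *)
  | Tone
  | Tten of exch_term & exch_term
  | Tprod of exch_term & exch_term
  | Tsum of exch_term & exch_term
  | Titp of exch_term                     (* U^× *)
  | Tits of exch_term.                    (* U^+ *)

Inductive exch_eq : exch_term -> exch_term -> Prop :=
  | Xrefl U : exch_eq U U
  | Xsym U W : exch_eq U W -> exch_eq W U
  | Xtrans U V W : exch_eq U V -> exch_eq V W -> exch_eq U W
  | Xten U U' W W' :
      exch_eq U U' -> exch_eq W W' -> exch_eq (Tten U W) (Tten U' W')
  | Xprod U U' W W' :
      exch_eq U U' -> exch_eq W W' -> exch_eq (Tprod U W) (Tprod U' W')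
  | Xsum U U' W W' :
      exch_eq U U' -> exch_eq W W' -> exch_eq (Tsum U W) (Tsum U' W')
  | Xitp U U' : exch_eq U U' -> exch_eq (Titp U) (Titp U')
  | Xits U U' : exch_eq U U' -> exch_eq (Tits U) (Tits U')
  | XtenA U V W : exch_eq (Tten U (Tten V W)) (Tten (Tten U V) W)
  | Xten1l U : exch_eq (Tten Tone U) U
  | Xten1r U : exch_eq (Tten U Tone) U
  | XitpE U : exch_eq (Titp U) (Tprod Tone (Tten U (Titp U)))
  | XitsE U : exch_eq (Tits U) (Tsum Tone (Tten U (Tits U))).

Definition exch_car := quot Xrefl Xsym Xtrans.
Definition ecl (t : exch_term) : exch_car := quot_class Xrefl Xsym Xtrans t.
Definition erp (u : exch_car) : exch_term := quot_repr u.

Lemma erpK u : ecl (erp u) = u. Proof. exact: quot_reprK. Qed.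
Lemma eclP t t' : ecl t = ecl t' <-> exch_eq t t'.
Proof. exact: quot_classP. Qed.
Lemma erp_ecl t : exch_eq (erp (ecl t)) t. Proof. exact: quot_repr_class. Qed.

Definition eten (U W : exch_car) := ecl (Tten (erp U) (erp W)).

Fact etenA U V W : eten U (eten V W) = eten (eten U V) W.
Proof.
apply/eclP; apply: (Xtrans (Xten (Xrefl _) (erp_ecl _))).
exact: (Xtrans (XtenA _ _ _) (Xten (Xsym (erp_ecl _)) (Xrefl _))).
Qed.
Fact eten1l U : eten (ecl Tone) U = U.
Proof.
rewrite -[RHS]erpK; apply/eclP.
exact: (Xtrans (Xten (erp_ecl _) (Xrefl _)) (Xten1l _)).
Qed.
Fact eten1r U : eten U (ecl Tone) = U.
Proof.
rewrite -[RHS]erpK; apply/eclP.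
exact: (Xtrans (Xten (Xrefl _) (erp_ecl _)) (Xten1r _)).
Qed.

Definition exch : monoid := Monoid etenA eten1l eten1r.

Definition eout (A : A0) : exch := ecl (Tout A).
Definition ein (A : A0) : exch := ecl (Tin A).
Definition eprod (U W : exch) : exch := ecl (Tprod (erp U) (erp W)).
Definition esum (U W : exch) : exch := ecl (Tsum (erp U) (erp W)).
Definition eitp (U : exch) : exch := ecl (Titp (erp U)).
Definition eits (U : exch) : exch := ecl (Tits (erp U)).

Lemma eitpE U : eitp U = eprod mun (U ** eitp U).
Proof.
apply/eclP; apply: (Xtrans (XitpE _)); apply: Xsym.
apply: Xprod; first exact: erp_ecl.
by apply: (Xtrans (erp_ecl _)); apply: Xten (Xrefl _) (erp_ecl _).
Qed.

Lemma eitsE U : eits U = esum mun (U ** eits U).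
Proof.
apply/eclP; apply: (Xtrans (XitsE _)); apply: Xsym.
apply: Xsum; first exact: erp_ecl.
by apply: (Xtrans (erp_ecl _)); apply: Xten (Xrefl _) (erp_ecl _).
Qed.
End Exchanges.

Section FreeCornering.
Variable A : distMonCat.
Notation A0 := (ob_monoid A).
Notation AV := (exch A).
Implicit Types (X Y Z : A0) (U V W K : AV).

(* Formal cells, before the equations are imposed. *)
Inductive pcell : AV -> A0 -> A0 -> AV -> Type :=
  | Phcomp U X Y V X' Y' W (a : pcell U X Y V) (b : pcell V X' Y' W) :
      pcell U (X ** X') (Y ** Y') W
  | Pvcomp U X Z W U' Y W' (a : pcell U X Z W) (b : pcell U' Z Y W') :
      pcell (U ** U') X Y (W ** W')
  | Phid U : pcell U mun mun U
  | Pvid X : pcell mun X X mun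
  | Pbox X Y (f : @hom A X Y) : pcell mun X Y mun
  | PgetL X : pcell (eout X) mun X mun
  | PputR X : pcell mun X mun (eout X)
  | PgetR X : pcell mun mun X (ein X)
  | PputL X : pcell (ein X) X mun mun
  | Ppi0 U W : pcell (eprod U W) mun mun U
  | Ppi1 U W : pcell (eprod U W) mun mun W
  | Pprod V X Y U W (a : pcell V X Y U) (b : pcell V X Y W) :
      pcell V X Y (eprod U W)
  | Piota0 U W : pcell U mun mun (esum U W)
  | Piota1 U W : pcell W mun mun (esum U W)
  | Psum U W X Y V (a : pcell U X Y V) (b : pcell W X Y V) :
      pcell (esum U W) X Y V
  | Pcopair U X Y Z W (a : pcell U X Z W) (b : pcell U Y Z W) :
      pcell U (@oplus A X Y) Z W
  | Pitp V X U W Y K (a : pcell V X X U) (f : pcell W X Y K)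
      (g : pcell W mun mun (V ** W)) : pcell W X Y (eitp U ** K)
  | Pits U X V K Y W (a : pcell U X X V) (f : pcell K X Y W)
      (g : pcell (V ** W) mun mun W) : pcell (eits U ** K) X Y W.

Notation "a :| b" := (Phcomp a b) (at level 48, left associativity).
Notation "a :/ b" := (Pvcomp a b) (at level 47, left associativity).

(* Projections of U^× = I × (U ⊗ U^×), injections of U^+ = I + (U ⊗ U^+). *)
Definition Ptpi0 U : pcell (eitp U) mun mun mun :=
  cell_cast (esym (eitpE U)) erefl erefl erefl (Ppi0 mun (U ** eitp U)).
Definition Ptpi1 U : pcell (eitp U) mun mun (U ** eitp U) :=
  cell_cast (esym (eitpE U)) erefl erefl erefl (Ppi1 mun (U ** eitp U)).
Definition Psiota0 U : pcell mun mun mun (eits U) :=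
  cell_cast erefl erefl erefl (esym (eitsE U)) (Piota0 mun (U ** eits U)).
Definition Psiota1 U : pcell (U ** eits U) mun mun (eits U) :=
  cell_cast erefl erefl erefl (esym (eitsE U)) (Piota1 mun (U ** eits U)).

Reserved Notation "a ~~ b" (at level 70).

(* Equality of formal cells.  It relates cells whose boundaries are merely
   provably equal ([peq_boundary]), as both sides of an equation often are.
   Congruence for the operations with a uniqueness clause follows from it. *)
Inductive peq : forall U X Y W U' X' Y' W',
    pcell U X Y W -> pcell U' X' Y' W' -> Prop :=
  | Erefl U X Y W (a : pcell U X Y W) : a ~~ a
  | Esym U X Y W (a : pcell U X Y W) U' X' Y' W' (b : pcell U' X' Y' W') :
      a ~~ b -> b ~~ a
  | Etrans U X Y W (a : pcell U X Y W) U' X' Y' W' (b : pcell U' X' Y' W')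
      U'' X'' Y'' W'' (c : pcell U'' X'' Y'' W'') : a ~~ b -> b ~~ c -> a ~~ c
  | Ehcomp U X Y V (a : pcell U X Y V) X' Y' W (b : pcell V X' Y' W)
      U2 X2 Y2 V2 (a2 : pcell U2 X2 Y2 V2) X2' Y2' W2
      (b2 : pcell V2 X2' Y2' W2) : a ~~ a2 -> b ~~ b2 -> a :| b ~~ a2 :| b2
  | Evcomp U X Z W (a : pcell U X Z W) U' Y W' (b : pcell U' Z Y W')
      U2 X2 Z2 W2 (a2 : pcell U2 X2 Z2 W2) U2' Y2 W2'
      (b2 : pcell U2' Z2 Y2 W2') : a ~~ a2 -> b ~~ b2 -> a :/ b ~~ a2 :/ b2
  | EhcompA U X Y V X' Y' W X'' Y'' K (a : pcell U X Y V) (b : pcell V X' Y' W)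
      (c : pcell W X'' Y'' K) : a :| (b :| c) ~~ a :| b :| c
  | Ehcomp_idl U X Y W (a : pcell U X Y W) : Phid U :| a ~~ a
  | Ehcomp_idr U X Y W (a : pcell U X Y W) : a :| Phid W ~~ a
  | EvcompA U X Y W U' Z W' U'' Z' W'' (a : pcell U X Y W)
      (b : pcell U' Y Z W') (c : pcell U'' Z Z' W'') :
      a :/ (b :/ c) ~~ a :/ b :/ c
  | Evcomp_idl U X Y W (a : pcell U X Y W) : Pvid X :/ a ~~ a
  | Evcomp_idr U X Y W (a : pcell U X Y W) : a :/ Pvid Y ~~ a
  | Ehid_vid : Phid mun ~~ Pvid mun
  | Evid_op X Y : Pvid (X ** Y) ~~ Pvid X :| Pvid Y
  | Ehid_op U W : Phid (U ** W) ~~ Phid U :/ Phid W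
  | Einterchange U X Z W U' Y W' X' Z' K Y' K' (a : pcell U X Z W)
      (b : pcell U' Z Y W') (c : pcell W X' Z' K) (d : pcell W' Z' Y' K') :
      (a :/ b) :| (c :/ d) ~~ (a :| c) :/ (b :| d)
  | Ebox_comp X Y Z (f : @hom A X Y) (g : @hom A Y Z) :
      Pbox (f ;; g) ~~ Pbox f :/ Pbox g
  | Ebox_id X : Pbox (@idm A X) ~~ Pvid X
  | Ebox_ten X Y X' Y' (f : @hom A X Y) (g : @hom A X' Y') :
      @Pbox (X ** X') (Y ** Y') (tenm f g) ~~ Pbox f :| Pbox g
  | EputR_getL X : PputR X :| PgetL X ~~ Pvid X
  | EgetL_putR_vert X : PgetL X :/ PputR X ~~ Phid (eout X)
  | EgetR_putL X : PgetR X :| PputL X ~~ Pvid X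
  | EgetR_putL_vert X : PgetR X :/ PputL X ~~ Phid (ein X)
  | Eprod_pi0 V X Y U W (a : pcell V X Y U) (b : pcell V X Y W) :
      Pprod a b :| Ppi0 U W ~~ a
  | Eprod_pi1 V X Y U W (a : pcell V X Y U) (b : pcell V X Y W) :
      Pprod a b :| Ppi1 U W ~~ b
  | Eprod_uniq V X Y U W (a : pcell V X Y U) (b : pcell V X Y W)
      (c : pcell V X Y (eprod U W)) :
      c :| Ppi0 U W ~~ a -> c :| Ppi1 U W ~~ b -> c ~~ Pprod a b
  | Esum_iota0 U W X Y V (a : pcell U X Y V) (b : pcell W X Y V) :
      Piota0 U W :| Psum a b ~~ a
  | Esum_iota1 U W X Y V (a : pcell U X Y V) (b : pcell W X Y V) :
      Piota1 U W :| Psum a b ~~ b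
  | Esum_uniq U W X Y V (a : pcell U X Y V) (b : pcell W X Y V)
      (c : pcell (esum U W) X Y V) :
      Piota0 U W :| c ~~ a -> Piota1 U W :| c ~~ b -> c ~~ Psum a b
  | Ecopair_inj0 U X Y Z W (a : pcell U X Z W) (b : pcell U Y Z W) :
      Pbox (@inj0 A X Y) :/ Pcopair a b ~~ a
  | Ecopair_inj1 U X Y Z W (a : pcell U X Z W) (b : pcell U Y Z W) :
      Pbox (@inj1 A X Y) :/ Pcopair a b ~~ b
  | Ecopair_uniq U X Y Z W (a : pcell U X Z W) (b : pcell U Y Z W)
      (c : pcell U (@oplus A X Y) Z W) :
      Pbox (@inj0 A X Y) :/ c ~~ a -> Pbox (@inj1 A X Y) :/ c ~~ b ->
      c ~~ Pcopair a b
  | Eitp_pi0 V X U W Y K (a : pcell V X X U) (f : pcell W X Y K)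
      (g : pcell W mun mun (V ** W)) :
      Pitp a f g :| (Ptpi0 U :/ Phid K) ~~ f
  | Eitp_pi1 V X U W Y K (a : pcell V X X U) (f : pcell W X Y K)
      (g : pcell W mun mun (V ** W)) :
      Pitp a f g :| (Ptpi1 U :/ Phid K) ~~ g :| (a :/ Pitp a f g)
  | Eitp_uniq V X U W Y K (a : pcell V X X U) (f : pcell W X Y K)
      (g : pcell W mun mun (V ** W)) (c : pcell W X Y (eitp U ** K)) :
      c :| (Ptpi0 U :/ Phid K) ~~ f ->
      c :| (Ptpi1 U :/ Phid K) ~~ g :| (a :/ c) -> c ~~ Pitp a f g
  | Eits_iota0 U X V K Y W (a : pcell U X X V) (f : pcell K X Y W)
      (g : pcell (V ** W) mun mun W) :
      (Psiota0 U :/ Phid K) :| Pits a f g ~~ f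
  | Eits_iota1 U X V K Y W (a : pcell U X X V) (f : pcell K X Y W)
      (g : pcell (V ** W) mun mun W) :
      (Psiota1 U :/ Phid K) :| Pits a f g ~~ (a :/ Pits a f g) :| g
  | Eits_uniq U X V K Y W (a : pcell U X X V) (f : pcell K X Y W)
      (g : pcell (V ** W) mun mun W) (c : pcell (eits U ** K) X Y W) :
      (Psiota0 U :/ Phid K) :| c ~~ f ->
      (Psiota1 U :/ Phid K) :| c ~~ (a :/ c) :| g -> c ~~ Pits a f g
where "a ~~ b" := (peq a b).

Lemma peq_boundary U X Y W (a : pcell U X Y W) U' X' Y' W'
    (b : pcell U' X' Y' W') :
  a ~~ b -> [/\ U = U', X = X', Y = Y' & W = W'].
Proof.
elim=> *; repeat match goal with h : [/\ _, _, _ & _] |- _ =>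
  case: h => ? ? ? ? end; subst; split; rewrite // ?mop1l ?mop1r ?mopA //.
Qed.

Definition ccell U X Y W : Type :=
  @quot (pcell U X Y W) (fun a b => a ~~ b) (@Erefl U X Y W)
    (fun a b => @Esym _ _ _ _ a _ _ _ _ b)
    (fun a b c => @Etrans _ _ _ _ a _ _ _ _ b _ _ _ _ c).
Definition ccl U X Y W (a : pcell U X Y W) : ccell U X Y W := quot_class _ _ _ a.
Definition crp U X Y W (c : ccell U X Y W) : pcell U X Y W := quot_repr c.

Lemma crpK U X Y W (c : ccell U X Y W) : ccl (crp c) = c.
Proof. exact: quot_reprK. Qed.
Lemma crp_ccl U X Y W (a : pcell U X Y W) : crp (ccl a) ~~ a.
Proof. exact: quot_repr_class. Qed.
Lemma cclP U X Y W (a b : pcell U X Y W) : ccl a = ccl b <-> a ~~ b.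
Proof. exact: quot_classP. Qed.

Lemma ccl_eq U X Y W (a : pcell U X Y W) U' X' Y' W' (b : pcell U' X' Y' W') :
  a ~~ b -> ccl a =~ ccl b.
Proof.
move=> h; have [eU eX eY eW] := peq_boundary h; subst.
by move/cclP: h => ->.
Qed.

(* Operations on classes are computed on chosen representatives. *)
Definition chcomp U X Y V X' Y' W (a : ccell U X Y V) (b : ccell V X' Y' W) :=
  ccl (crp a :| crp b).
Definition cvcomp U X Z W U' Y W' (a : ccell U X Z W) (b : ccell U' Z Y W') :=
  ccl (crp a :/ crp b).
Definition chid U := ccl (Phid U).
Definition cvid X := ccl (Pvid X).

Local Ltac unrepr := repeat (apply: Ehcomp || apply: Evcomp);
  try exact: Erefl; try exact: crp_ccl; try (apply: Esym; exact: crp_ccl).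

Fact chcompA U X Y V X' Y' W X'' Y'' K
    (a : ccell U X Y V) (b : ccell V X' Y' W) (c : ccell W X'' Y'' K) :
  chcomp a (chcomp b c) =~ chcomp (chcomp a b) c.
Proof.
apply: ccl_eq; apply: (@Etrans _ _ _ _ _ _ _ _ _ (crp a :| (crp b :| crp c))).
  by unrepr.
by apply: (Etrans (EhcompA _ _ _)); unrepr.
Qed.
Fact chcomp_idl U X Y W (a : ccell U X Y W) : chcomp (chid U) a =~ a.
Proof.
rewrite -{2}(crpK a); apply: ccl_eq.
by apply: Etrans (Ehcomp_idl _); unrepr.
Qed.
Fact chcomp_idr U X Y W (a : ccell U X Y W) : chcomp a (chid W) =~ a.
Proof.
rewrite -{2}(crpK a); apply: ccl_eq.
by apply: Etrans (Ehcomp_idr _); unrepr.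
Qed.
Fact cvcompA U X Y W U' Z W' U'' Z' W''
    (a : ccell U X Y W) (b : ccell U' Y Z W') (c : ccell U'' Z Z' W'') :
  cvcomp a (cvcomp b c) =~ cvcomp (cvcomp a b) c.
Proof.
apply: ccl_eq; apply: (@Etrans _ _ _ _ _ _ _ _ _ (crp a :/ (crp b :/ crp c))).
  by unrepr.
by apply: (Etrans (EvcompA _ _ _)); unrepr.
Qed.
Fact cvcomp_idl U X Y W (a : ccell U X Y W) : cvcomp (cvid X) a =~ a.
Proof.
rewrite -{2}(crpK a); apply: ccl_eq.
by apply: Etrans (Evcomp_idl _); unrepr.
Qed.
Fact cvcomp_idr U X Y W (a : ccell U X Y W) : cvcomp a (cvid Y) =~ a.
Proof.
rewrite -{2}(crpK a); apply: ccl_eq.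
by apply: Etrans (Evcomp_idr _); unrepr.
Qed.
Fact chid_vid : chid mun = cvid mun.
Proof. by apply/cclP; exact: Ehid_vid. Qed.
Fact cvid_op X Y : cvid (X ** Y) = chcomp (cvid X) (cvid Y).
Proof. by apply/cclP; apply: (Etrans (Evid_op _ _)); unrepr. Qed.
Fact chid_op U W : chid (U ** W) = cvcomp (chid U) (chid W).
Proof. by apply/cclP; apply: (Etrans (Ehid_op _ _)); unrepr. Qed.
Fact cinterchange U X Z W U' Y W' X' Z' K Y' K'
    (a : ccell U X Z W) (b : ccell U' Z Y W')
    (c : ccell W X' Z' K) (d : ccell W' Z' Y' K') :
  chcomp (cvcomp a b) (cvcomp c d) = cvcomp (chcomp a c) (chcomp b d).
Proof.
apply/cclP; apply: (@Etrans _ _ _ _ _ _ _ _ _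
  ((crp a :/ crp b) :| (crp c :/ crp d))); first by unrepr.
by apply: (Etrans (Einterchange _ _ _ _)); unrepr.
Qed.

Definition cornering : doubleCat :=
  DoubleCat chcompA chcomp_idl chcomp_idr cvcompA cvcomp_idl cvcomp_idr
    chid_vid cvid_op chid_op cinterchange.

Notation Cell := (@cell cornering).
Notation Hid := (@hid cornering).
Notation Vid := (@vid cornering).

Definition tpi0 U : Cell (eitp U) mun mun mun := ccl (Ptpi0 U).
Definition tpi1 U : Cell (eitp U) mun mun (U ** eitp U) := ccl (Ptpi1 U).
Definition siota0 U : Cell mun mun mun (eits U) := ccl (Psiota0 U).
Definition siota1 U : Cell (U ** eits U) mun mun (eits U) := ccl (Psiota1 U).

(* α^×_{f,g} and α^+_{f,g} *)
Definition itp V X U W Y K (a : Cell V X X U) (f : Cell W X Y K)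
    (g : Cell W mun mun (V ** W)) : Cell W X Y (eitp U ** K) :=
  ccl (Pitp (crp a) (crp f) (crp g)).
Definition its U X V K Y W (a : Cell U X X V) (f : Cell K X Y W)
    (g : Cell (V ** W) mun mun W) : Cell (eits U ** K) X Y W :=
  ccl (Pits (crp a) (crp f) (crp g)).

(* α^× and α^+; the casts only use unitality of the edge monoids. *)
Definition timesm X U W (a : Cell U X X W) : Cell (eitp U) X X (eitp W) :=
  cell_cast erefl erefl erefl (mop1r _)
    (itp a (cell_cast erefl (mop1l X) (mop1l X) erefl (tpi0 U <|> Vid X))
       (tpi1 U)).
Definition plusm X U W (a : Cell U X X W) : Cell (eits U) X X (eits W) :=
  cell_cast (mop1r _) erefl erefl erefl
    (its a (cell_cast erefl (mop1r X) (mop1r X) erefl (Vid X <|> siota0 W))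
       (siota1 W)).

Definition Delta U : Cell (eitp U) mun mun (eitp U ** eitp U) :=
  itp (Hid U) (Hid (eitp U)) (tpi1 U).
Definition Nabla U : Cell (eits U ** eits U) mun mun (eits U) :=
  its (Hid U) (Hid (eits U)) (siota1 U).

Definition epsilon U : Cell (eitp U) mun mun U :=
  cell_cast erefl (mop1l _) (mop1l _) (mop1r U) (tpi1 U <|> (Hid U </> tpi0 U)).
Definition delta U : Cell (eitp U) mun mun (eitp (eitp U)) :=
  cell_cast erefl erefl erefl (mop1r _) (itp (Hid (eitp U)) (tpi0 U) (Delta U)).

Definition eta U : Cell U mun mun (eits U) :=
  cell_cast (mop1r U) (mop1l _) (mop1l _) erefl ((Hid U </> siota0 U) <|> siota1 U).
Definition mu U : Cell (eits (eits U)) mun mun (eits U) :=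
  cell_cast (mop1r _) erefl erefl erefl (its (Hid (eits U)) (siota0 U) (Nabla U)).
End FreeCornering.

(* Main.v *)
(* In a strict monoidal category call U^× = I × (U ⊗ U^×), with projections
   [p0] and [p1], coiterative when a map h : W -> U^× ⊗ K is determined by
   h (p0 ⊗ 1) and by an equation h (p1 ⊗ 1) = g (a ⊗ h).  All comonad laws
   follow by exhibiting both sides as solutions of the same equation; the
   only intermediate facts are that Δ is coassociative and that both a^× and δ
   commute with Δ.  Part (ii) is part (i) in the opposite of the
   category of horizontal cells. *)
From mathcomp Require Import all_boot boolp.
Require Import Defs.

Set Implicit Arguments.
Unset Strict Implicit.
Unset Printing Implicit Defensive.

Section StrictCoherence.
Variable C : strictMonCat.
Implicit Types a b c d : C.

Definition eqm a b (e : a = b) : hom a b := ecast x (hom a x) e (idm a).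

Lemma eqm_irr a b (e e' : a = b) : eqm e = eqm e'.
Proof. by rewrite (Prop_irrelevance e e'). Qed.

Lemma eqm_id a (e : a = a) : eqm e = idm a.
Proof. by rewrite (eqm_irr e erefl). Qed.

Lemma eqm_comp a b c (e : a = b) (e' : b = c) :
  eqm e ;; eqm e' = eqm (etrans e e').
Proof. by case: c / e'; rewrite comp_idr. Qed.

Lemma hom_eqP a b c d (f : hom a b) (g : hom c d) :
  hom_eq f g -> forall (ea : a = c) (eb : b = d), f ;; eqm eb = eqm ea ;; g.
Proof. by case=> ea eb; rewrite !eqm_id comp_idl comp_idr. Qed.

Lemma eqm_hom_eq a b c d (f : hom a b) (g : hom c d) (ea : a = c) (eb : b = d) :
  f ;; eqm eb = eqm ea ;; g -> hom_eq f g.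
Proof.
by case: c / ea g; case: d / eb => g; rewrite comp_idl comp_idr => <-.
Qed.

Lemma tenm1_eqm a b c (e : b = c) :
  tenm (idm a) (eqm e) = eqm (congr1 (ten a) e).
Proof. by case: c / e; rewrite tenm_id. Qed.

Lemma tenm_eqm1 a b c (e : b = c) :
  tenm (eqm e) (idm a) = eqm (congr1 (fun x => ten x a) e).
Proof. by case: c / e; rewrite tenm_id. Qed.

Definition asc a b c := eqm (tenA a b c).
Definition iasc a b c := eqm (esym (tenA a b c)).
Definition lun a := eqm (ten1l a).
Definition run a := eqm (ten1r a).
Definition irun a := eqm (esym (ten1r a)).

Lemma asc_natural a a' b b' c c' (f : hom a a') (g : hom b b') (h : hom c c') :
  asc a b c ;; tenm (tenm f g) h = tenm f (tenm g h) ;; asc a' b' c'.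
Proof. exact: esym (hom_eqP (tenmA f g h) _ _). Qed.

Lemma lun_natural a b (f : hom a b) :
  tenm (idm _) f ;; lun b = lun a ;; f.
Proof. exact: hom_eqP (tenm1l f) _ _. Qed.

Lemma run_natural a b (f : hom a b) :
  tenm f (idm _) ;; run b = run a ;; f.
Proof. exact: hom_eqP (tenm1r f) _ _. Qed.

Lemma ascK a b c : asc a b c ;; iasc a b c = idm _.
Proof. by rewrite eqm_comp eqm_id. Qed.

Lemma iascK a b c : iasc a b c ;; asc a b c = idm _.
Proof. by rewrite eqm_comp eqm_id. Qed.

Lemma runK a : run a ;; irun a = idm _.
Proof. by rewrite eqm_comp eqm_id. Qed.

Lemma irunK a : irun a ;; run a = idm _.
Proof. by rewrite eqm_comp eqm_id. Qed.

Lemma iasc_natural a a' b b' c c' (f : hom a a') (g : hom b b') (h : hom c c') :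
  iasc a b c ;; tenm f (tenm g h) = tenm (tenm f g) h ;; iasc a' b' c'.
Proof.
rewrite -[LHS]comp_idr -(ascK a' b' c') comp_assoc -(comp_assoc (iasc _ _ _)).
by rewrite -asc_natural (comp_assoc (iasc _ _ _)) iascK comp_idl.
Qed.

Lemma irun_natural a b (f : hom a b) :
  irun a ;; tenm f (idm _) = f ;; irun b.
Proof.
rewrite -[LHS]comp_idr -(runK b) comp_assoc -(comp_assoc (irun _)) run_natural.
by rewrite (comp_assoc (irun _)) irunK comp_idl.
Qed.

Lemma run_ten a b : asc a b _ ;; run (ten a b) = tenm (idm a) (run b).
Proof. by rewrite tenm1_eqm eqm_comp; apply: eqm_irr. Qed.

Lemma irun_ten a b : irun (ten a b) = tenm (idm a) (irun b) ;; asc a b _.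
Proof. by rewrite tenm1_eqm eqm_comp; apply: eqm_irr. Qed.

Lemma lun_ten a b : iasc _ a b ;; lun (ten a b) = tenm (lun a) (idm b).
Proof. by rewrite tenm_eqm1 eqm_comp; apply: eqm_irr. Qed.

Lemma lun_tenun : lun (tenun C) = run (tenun C).
Proof. exact: eqm_irr. Qed.

Lemma asc_pentagon a b c d :
  asc a (ten b c) d ;; tenm (asc a b c) (idm d) ;; iasc (ten a b) c d =
  tenm (idm a) (iasc b c d) ;; asc a b (ten c d).
Proof. by rewrite tenm1_eqm tenm_eqm1 !eqm_comp; apply: eqm_irr. Qed.

Lemma tenmK a b c a' b' c' (f : hom a b) (g : hom b c) (f' : hom a' b')
    (g' : hom b' c') : tenm f f' ;; tenm g g' = tenm (f ;; g) (f' ;; g') .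
Proof. by rewrite tenm_comp. Qed.

Lemma tenm_compl a b c d e (f : hom a b) (g : hom b c) (h : hom d e) :
  tenm (f ;; g) h = tenm f (idm d) ;; tenm g h.
Proof. by rewrite -tenm_comp comp_idl. Qed.

Lemma tenm_compr a b c d e (f : hom a b) (g : hom b c) (h : hom d e) :
  tenm h (f ;; g) = tenm (idm d) f ;; tenm h g.
Proof. by rewrite -tenm_comp comp_idl. Qed.

Lemma tenm_lr a b c d (f : hom a b) (g : hom c d) :
  tenm f g = tenm f (idm c) ;; tenm (idm b) g.
Proof. by rewrite -tenm_comp comp_idl comp_idr. Qed.

Lemma tenm_rl a b c d (f : hom a b) (g : hom c d) :
  tenm f g = tenm (idm a) g ;; tenm f (idm d).
Proof. by rewrite -tenm_comp comp_idl comp_idr. Qed.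
End StrictCoherence.

(* Composites nest to the left, so an equation applies to an inner factor only
   once it is extended by what precedes it. *)
Lemma comp_rewrite (C : category) (x y z : C) (f : hom x y) (g : hom y z)
    (fg : hom x z) : f ;; g = fg ->
  forall w (k : hom w x), k ;; f ;; g = k ;; fg.
Proof. by move=> <- w k; rewrite comp_assoc. Qed.

Lemma comp_rewrite3 (C : category) (x y z t : C) (f : hom x y) (g : hom y z)
    (h : hom z t) (fgh : hom x t) : f ;; g ;; h = fgh ->
  forall w (k : hom w x), k ;; f ;; g ;; h = k ;; fgh.
Proof. by move=> <- w k; rewrite !comp_assoc. Qed.

Section CoiterationComonad.
Variables (C : strictMonCat) (T : C -> C).
Variables (p0 : forall a, hom (T a) (tenun C))
          (p1 : forall a, hom (T a) (ten a (T a))).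
Implicit Types a b c k w : C.

Definition coiterates a b w k (u : hom a b) (f : hom w k) (g : hom w (ten a w))
    (h : hom w (ten (T b) k)) : Prop :=
  hom_eq (h ;; tenm (p0 b) (idm k)) f /\
  hom_eq (h ;; tenm (p1 b) (idm k)) (g ;; tenm u h).

Lemma coiteratesP a b w k (u : hom a b) (f : hom w k) (g : hom w (ten a w))
    (h : hom w (ten (T b) k)) :
  coiterates u f g h <->
  h ;; tenm (p0 b) (idm k) ;; lun k = f /\
  h ;; tenm (p1 b) (idm k) = g ;; tenm u h ;; asc b (T b) k.
Proof.
split=> [[h0 h1]|[h0 h1]].
  split; first by rewrite (hom_eqP h0 erefl) comp_idl.
  have /(congr1 (fun m => m ;; asc _ _ _)) :=
    hom_eqP h1 erefl (esym (tenA _ _ _)).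
  by rewrite comp_idl -[X in X = _]comp_assoc iascK comp_idr.
split; first by apply: eqm_hom_eq erefl (ten1l k) _; rewrite comp_idl.
apply: eqm_hom_eq erefl (esym (tenA _ _ _)) _.
by rewrite h1 -[X in X = _]comp_assoc ascK comp_idl comp_idr.
Qed.

Hypothesis coiterates_uniq : forall a b w k (u : hom a b) (f : hom w k)
  (g : hom w (ten a w)) (h h' : hom w (ten (T b) k)),
  coiterates u f g h -> coiterates u f g h' -> h = h'.

Lemma coiterates_uniq1 a b w (u : hom a b) (f : hom w (tenun C))
    (g : hom w (ten a w)) (h h' : hom w (T b)) :
  h ;; p0 b = f -> h ;; p1 b = g ;; tenm u h ->
  h' ;; p0 b = f -> h' ;; p1 b = g ;; tenm u h' -> h = h'.
Proof.
suff H (m : hom w (T b)) : m ;; p0 b = f -> m ;; p1 b = g ;; tenm u m ->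
    coiterates u f g (m ;; irun (T b)).
  move=> h0 h1 h'0 h'1; have := coiterates_uniq (H _ h0 h1) (H _ h'0 h'1).
  move/(congr1 (fun m => m ;; run _)).
  by rewrite !(comp_rewrite (irunK _)) !comp_idr.
move=> m0 m1; apply/coiteratesP; split.
  rewrite (comp_rewrite (irun_natural _)) comp_assoc m0 lun_tenun.
  by rewrite (comp_rewrite (irunK _)) comp_idr.
rewrite (comp_rewrite (irun_natural _)) comp_assoc m1 irun_ten comp_assoc.
by rewrite -[u in RHS]comp_idr tenm_comp comp_assoc.
Qed.

Variables (Tm : forall a b, hom a b -> hom (T a) (T b))
  (Dl : forall a, hom (T a) (ten (T a) (T a)))
  (eps : forall a, hom (T a) a) (dl : forall a, hom (T a) (T (T a))).
Hypothesis Tm0 : forall a b (f : hom a b), Tm f ;; p0 b = p0 a.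
Hypothesis Tm1 : forall a b (f : hom a b), Tm f ;; p1 b = p1 a ;; tenm f (Tm f).
Hypothesis DlP : forall a, coiterates (idm a) (idm (T a)) (p1 a) (Dl a).
Hypothesis epsE : forall a, eps a = p1 a ;; tenm (idm a) (p0 a) ;; run a.
Hypothesis dl0 : forall a, dl a ;; p0 (T a) = p0 a.
Hypothesis dl1 : forall a, dl a ;; p1 (T a) = Dl a ;; tenm (idm _) (dl a).

Lemma Dl0 a : Dl a ;; tenm (p0 a) (idm (T a)) ;; lun (T a) = idm (T a).
Proof. by have /coiteratesP[] := DlP a. Qed.

Lemma Dl1 a : Dl a ;; tenm (p1 a) (idm (T a)) =
  p1 a ;; tenm (idm a) (Dl a) ;; asc _ _ _.
Proof. by have /coiteratesP[] := DlP a. Qed.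

Lemma Dl_p0 a b (f : hom (T a) b) :
  Dl a ;; tenm (p0 a) f ;; lun b = f.
Proof.
rewrite tenm_lr comp_assoc (comp_rewrite (lun_natural _)) comp_assoc Dl0.
by rewrite comp_idl.
Qed.

Lemma Tm_Dl a b (f : hom a b) : Tm f ;; Dl b = Dl a ;; tenm (Tm f) (Tm f).
Proof.
apply: (@coiterates_uniq _ _ _ _ f (Tm f) (p1 a)); apply/coiteratesP; split.
- by rewrite (comp_rewrite3 (Dl0 _)) comp_idr.
- rewrite (comp_rewrite (Dl1 _)) !comp_assoc Tm1.
  by rewrite (comp_rewrite (tenmK _ _ _ _)) comp_idr.
- by rewrite (comp_rewrite (tenmK _ _ _ _)) Tm0 comp_idr Dl_p0.
- rewrite (comp_rewrite (tenmK _ _ _ _)) Tm1 comp_idr tenm_compl comp_assoc Dl1.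
  rewrite (comp_rewrite (asc_natural _ _ _)) comp_assoc.
  by rewrite (comp_rewrite (tenmK _ _ _ _)) comp_idl.
Qed.

Lemma Dl_coassoc a :
  Dl a ;; tenm (idm _) (Dl a) = Dl a ;; tenm (Dl a) (idm _) ;; iasc _ _ _.
Proof.
apply: (@coiterates_uniq _ _ _ _ (idm a) (Dl a) (p1 a));
  apply/coiteratesP; split.
- by rewrite (comp_rewrite (tenmK _ _ _ _)) comp_idr comp_idl Dl_p0.
- rewrite (comp_rewrite (tenmK _ _ _ _)) comp_idr comp_idl tenm_lr comp_assoc Dl1.
  rewrite -tenm_id (comp_rewrite (asc_natural _ _ _)) comp_assoc.
  by rewrite (comp_rewrite (tenmK _ _ _ _)) comp_idl.
- rewrite -tenm_id (comp_rewrite (iasc_natural _ _ _)) comp_assoc.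
  rewrite (comp_rewrite (lun_ten _ _)).
  by rewrite -!(comp_assoc (Dl a)) -!tenm_compl Dl0 tenm_id comp_idr.
- rewrite -tenm_id (comp_rewrite (iasc_natural _ _ _)) comp_assoc.
  rewrite -(comp_assoc (Dl a)) -tenm_compl Dl1 !tenm_compl !comp_assoc Dl1.
  rewrite (comp_rewrite (asc_natural _ _ _)) comp_assoc.
  rewrite (comp_rewrite3 (asc_pentagon _ _ _ _)) comp_assoc.
  by rewrite !tenm_compr !comp_assoc.
Qed.

Lemma dl_Dl a : dl a ;; Dl (T a) = Dl a ;; tenm (dl a) (dl a).
Proof.
apply: (@coiterates_uniq _ _ _ _ (idm (T a)) (dl a) (Dl a)).
  apply/coiteratesP; split; first by rewrite (comp_rewrite3 (Dl0 _)) comp_idr.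
  rewrite (comp_rewrite (Dl1 _)) !comp_assoc dl1.
  by rewrite (comp_rewrite (tenmK _ _ _ _)) comp_idl.
apply/coiteratesP; split.
  by rewrite (comp_rewrite (tenmK _ _ _ _)) dl0 comp_idr Dl_p0.
rewrite (comp_rewrite (tenmK _ _ _ _)) dl1 comp_idr tenm_compl comp_assoc.
rewrite -[Dl a ;; tenm (Dl a) _]comp_idr -(iascK (T a)) comp_assoc -Dl_coassoc.
rewrite (comp_rewrite (asc_natural _ _ _)) comp_assoc.
by rewrite (comp_rewrite (tenmK _ _ _ _)) comp_idl.
Qed.

Lemma Dl_eps a : Dl a ;; tenm (eps a) (idm _) = p1 a.
Proof.
rewrite epsE !tenm_compl !comp_assoc Dl1 (comp_rewrite (asc_natural _ _ _)).
rewrite comp_assoc (comp_rewrite (tenmK _ _ _ _)) comp_idl.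
have tri : asc a (tenun C) (T a) ;; tenm (run a) (idm _) = tenm (idm a) (lun _).
  by rewrite tenm_eqm1 tenm1_eqm eqm_comp; apply: eqm_irr.
rewrite (comp_rewrite tri) (comp_rewrite (tenmK _ _ _ _)) Dl0 comp_idl.
by rewrite tenm_id comp_idr.
Qed.

Theorem coiteration_comonad : @is_comonad C T Tm eps dl.
Proof.
split.
- split=> [a|a b c f g].
    apply: (coiterates_uniq1 (Tm0 _) (Tm1 _)); first by rewrite comp_idl.
    by rewrite tenm_id comp_idl comp_idr.
  apply: (coiterates_uniq1 (Tm0 _) (Tm1 _)).
    by rewrite -comp_assoc !Tm0.
  by rewrite -comp_assoc Tm1 comp_assoc Tm1 -comp_assoc -tenm_comp.
- move=> a b f; rewrite !epsE !comp_assoc Tm1 (comp_rewrite (tenmK _ _ _ _)).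
  rewrite Tm0 comp_idr tenm_rl comp_assoc (comp_rewrite (run_natural _)).
  by rewrite comp_assoc.
- move=> a b f; apply: (@coiterates_uniq1 _ _ _ (Tm f) (p0 a) (Dl a)).
  + by rewrite -comp_assoc dl0 Tm0.
  + rewrite -comp_assoc dl1 comp_assoc Tm_Dl (comp_rewrite (tenmK _ _ _ _)).
    by rewrite comp_idr.
  + by rewrite -comp_assoc Tm0 dl0.
  + rewrite -comp_assoc Tm1 comp_assoc dl1 (comp_rewrite (tenmK _ _ _ _)).
    by rewrite comp_idl.
- move=> a; rewrite epsE !comp_assoc dl1 (comp_rewrite (tenmK _ _ _ _)) dl0.
  rewrite comp_idl; apply: (@coiterates_uniq1 _ _ _ (idm a) (p0 a) (p1 a)).
  + rewrite -comp_assoc -run_natural comp_assoc (comp_rewrite (tenmK _ _ _ _)).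
    by rewrite comp_idl comp_idr -lun_tenun Dl_p0.
  + rewrite -comp_assoc -run_natural comp_assoc (comp_rewrite (tenmK _ _ _ _)).
    rewrite comp_idl comp_idr tenm_lr comp_assoc Dl1 -tenm_id.
    rewrite (comp_rewrite (asc_natural _ _ _)) comp_assoc.
    rewrite (comp_rewrite (run_ten _ _)).
    by rewrite -!(comp_assoc (p1 a)) -!tenm_compr.
  + by rewrite comp_idl.
  + by rewrite comp_idl tenm_id comp_idr.
- move=> a; apply: (@coiterates_uniq1 _ _ _ (idm a) (p0 a) (p1 a)).
  + by rewrite -comp_assoc Tm0 dl0.
  + rewrite -comp_assoc Tm1 comp_assoc dl1 (comp_rewrite (tenmK _ _ _ _)) comp_idl.
    by rewrite tenm_lr comp_assoc Dl_eps.
  + by rewrite comp_idl.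
  + by rewrite comp_idl tenm_id comp_idr.
- move=> a; apply: (@coiterates_uniq1 _ _ _ (dl a) (p0 a) (Dl a)).
  + by rewrite -comp_assoc !dl0.
  + rewrite -comp_assoc dl1 comp_assoc dl_Dl (comp_rewrite (tenmK _ _ _ _)).
    by rewrite comp_idr.
  + by rewrite -comp_assoc Tm0 dl0.
  + rewrite -comp_assoc Tm1 comp_assoc dl1 (comp_rewrite (tenmK _ _ _ _)).
    by rewrite comp_idl.
Qed.
End CoiterationComonad.

Definition op_cat (C : category) : category :=
  @Category C (fun a b => @hom C b a) (fun a => idm a)
    (fun a b c f g => g ;; f) (fun a b f => comp_idr f)
    (fun a b f => comp_idl f) (fun a b c d f g h => esym (comp_assoc h g f)).

Lemma hom_eq_op (C : category) (a b a' b' : C) (f : hom a b) (g : hom a' b') :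
  hom_eq f g -> @hom_eq (op_cat C) b a f b' a' g.
Proof. by case. Qed.

Lemma hom_eq_opV (C : category) (a b a' b' : C) (f : hom a b) (g : hom a' b') :
  @hom_eq (op_cat C) b a f b' a' g -> hom_eq f g.
Proof. by case. Qed.

Definition op_smc (C : strictMonCat) : strictMonCat :=
  @StrictMonCat (op_cat C) (@ten C) (@tenun C) (@tenA C) (@ten1l C) (@ten1r C)
    (fun a b a' b' f g => tenm f g) (fun a a' => tenm_id a a')
    (fun a b c a' b' c' f g f' g' => tenm_comp g f g' f')
    (fun a a' b b' c c' f g h => hom_eq_op (tenmA f g h))
    (fun a b f => hom_eq_op (tenm1l f)) (fun a b f => hom_eq_op (tenm1r f)).

Lemma eqm_op (C : strictMonCat) (a b : C) (e : a = b) :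
  @eqm (op_smc C) a b e = @eqm C b a (esym e).
Proof. by case: b / e. Qed.

Lemma comonad_op (C : category) (T : C -> C)
    (Tm : forall a b : C, hom a b -> hom (T a) (T b))
    (eta : forall a, hom a (T a)) (mu : forall a, hom (T (T a)) (T a)) :
  @is_comonad (op_cat C) T (fun a b f => Tm b a f) eta mu ->
  is_monad Tm eta mu.
Proof.
case=> [[T1 T2] eN mN ml mr mA]; split.
- by split=> // a b c f g; apply: (T2 c b a g f).
- by move=> a b f; apply: esym (eN b a f).
- by move=> a b f; apply: esym (mN b a f).
- exact: ml.
- exact: mr.
- exact: mA.
Qed.

Section HorizontalMonoidal.
Variable D : doubleCat.
Implicit Types U V W X : dV D.

Lemma cell_hom_eq U W U' W' (a : cell U mun mun W) (b : cell U' mun mun W') :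
  a =~ b -> @hom_eq (Hcat D) U W a U' W' b.
Proof.
move=> h; have [eU _ _ eW] := cell_eq_boundary h.
by subst; rewrite (cell_eq_eq h); apply: HomEq.
Qed.

Lemma hom_cell_eq U W U' W' (a : cell U mun mun W) (b : cell U' mun mun W') :
  @hom_eq (Hcat D) U W a U' W' b -> a =~ b.
Proof. by case; apply: CellEq. Qed.

Lemma HcompE U V W (a : cell U mun mun V) (b : cell V mun mun W) :
  Hcomp a b =~ a <|> b.
Proof. exact: cell_cast_eq. Qed.

Lemma HcompP U V W (a : cell U mun mun V) (b : cell V mun mun W)
    U' A B W' (c : @cell D U' A B W') : Hcomp a b =~ c <-> a <|> b =~ c.
Proof.
split; apply: cell_eq_trans; last exact: HcompE.
exact: cell_eq_sym (HcompE _ _).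
Qed.

Lemma HcompP2 U V W (a : cell U mun mun V) (b : cell V mun mun W)
    U' V' W' (c : cell U' mun mun V') (d : @cell D V' mun mun W') :
  Hcomp a b =~ Hcomp c d <-> a <|> b =~ c <|> d.
Proof.
split=> [/HcompP|] h; first exact: cell_eq_trans h (HcompE _ _).
by apply/HcompP; apply: cell_eq_trans h (cell_eq_sym (HcompE _ _)).
Qed.

Lemma vcomp_cell_eq U A C W (a : cell U A C W) U2 A2 C2 W2
    (a2 : cell U2 A2 C2 W2) U' B W' (b : cell U' C B W')
    U2' B2 W2' (b2 : @cell D U2' C2 B2 W2') :
  a =~ a2 -> b =~ b2 -> a </> b =~ a2 </> b2.
Proof.
move=> h k; move: a2 h; case: k => a2 h.
have [eU eA _ eW] := cell_eq_boundary h; subst.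
by rewrite (cell_eq_eq h).
Qed.

Fact Htenm_id U W : hid U </> hid W = hid (U ** W).
Proof. by rewrite hid_op. Qed.

Fact Htenm_comp U V W U' V' W' (a : cell U mun mun V) (b : cell V mun mun W)
    (a' : cell U' mun mun V') (b' : cell V' mun mun W') :
  Hcomp a b </> Hcomp a' b' = @Hcomp D _ _ _ (a </> a') (b </> b').
Proof.
apply: cell_eq_eq.
apply: (cell_eq_trans (vcomp_cell_eq (HcompE _ _) (HcompE _ _))).
rewrite -interchange; apply: cell_eq_sym; exact: HcompE.
Qed.

Fact Hten1l U W (a : cell U mun mun W) : hid mun </> a =~ a.
Proof. by rewrite hid_vid; apply: vcomp_idl. Qed.

Fact Hten1r U W (a : cell U mun mun W) : a </> hid mun =~ a.
Proof. by rewrite hid_vid; apply: vcomp_idr. Qed.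

Definition Hsmc : strictMonCat :=
  @StrictMonCat (Hcat D) (@mop (dV D)) mun (@mopA _) (@mop1l _) (@mop1r _)
    (fun a b a' b' f g => f </> g) Htenm_id
    (fun a b c a' b' c' f g f' g' => Htenm_comp f g f' g')
    (fun a a' b b' c c' f g h => cell_hom_eq (vcompA f g h))
    (fun a b f => cell_hom_eq (Hten1l f)) (fun a b f => cell_hom_eq (Hten1r f)).
End HorizontalMonoidal.

Section Iteration.
Variable A : distMonCat.
Notation AV := (exch A).
Notation A0 := (ob_monoid A).
Notation Cell := (@cell (cornering A)).
Notation Hid := (@hid (cornering A)).
Implicit Types (U V W K : AV) (X Y : A0).

Lemma crp_eq U X Y W (c : Cell U X Y W) U' X' Y' W' (d : Cell U' X' Y' W') :
  c =~ d -> peq (crp c) (crp d).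
Proof. by case; apply: Erefl. Qed.

Lemma crp_hcomp U X Y V X' Y' W (a : Cell U X Y V) (b : Cell V X' Y' W) :
  peq (crp (a <|> b)) (Phcomp (crp a) (crp b)).
Proof. exact: crp_ccl. Qed.

Lemma crp_vcomp U X Z W U' Y W' (a : Cell U X Z W) (b : Cell U' Z Y W') :
  peq (crp (a </> b)) (Pvcomp (crp a) (crp b)).
Proof. exact: crp_ccl. Qed.

Lemma eq_crp U X Y W (c : Cell U X Y W) U' X' Y' W' (d : Cell U' X' Y' W') :
  peq (crp c) (crp d) -> c =~ d.
Proof. by move/ccl_eq; rewrite !crpK. Qed.

Section Itp.
Variables (V : AV) (X : A0) (U W : AV) (Y : A0) (K : AV).
Variables (a : Cell V X X U) (f : Cell W X Y K) (g : Cell W mun mun (V ** W)).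

Let crp_tpi0 (c : Cell W X Y (eitp U ** K)) :
  peq (crp (c <|> (tpi0 U </> Hid K)))
    (Phcomp (crp c) (Pvcomp (Ptpi0 U) (Phid K))).
Proof.
apply: (Etrans (crp_hcomp _ _)); apply: Ehcomp; first exact: Erefl.
by apply: (Etrans (crp_vcomp _ _)); apply: Evcomp; apply: crp_ccl.
Qed.

Let crp_tpi1 (c : Cell W X Y (eitp U ** K)) :
  peq (crp (c <|> (tpi1 U </> Hid K)))
    (Phcomp (crp c) (Pvcomp (Ptpi1 U) (Phid K))).
Proof.
apply: (Etrans (crp_hcomp _ _)); apply: Ehcomp; first exact: Erefl.
by apply: (Etrans (crp_vcomp _ _)); apply: Evcomp; apply: crp_ccl.
Qed.

Let crp_step (c : Cell W X Y (eitp U ** K)) :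
  peq (crp (g <|> (a </> c))) (Phcomp (crp g) (Pvcomp (crp a) (crp c))).
Proof.
apply: (Etrans (crp_hcomp _ _)); apply: Ehcomp; first exact: Erefl.
exact: crp_vcomp.
Qed.

Lemma itp_pi0 : itp a f g <|> (tpi0 U </> Hid K) =~ f.
Proof.
apply/eq_crp/(Etrans (crp_tpi0 _)).
apply: (Etrans _ (Eitp_pi0 (crp a) (crp f) (crp g))).
by apply: Ehcomp; [exact: crp_ccl | exact: Erefl].
Qed.

Lemma itp_pi1 :
  itp a f g <|> (tpi1 U </> Hid K) =~ g <|> (a </> itp a f g).
Proof.
apply/eq_crp/(Etrans (crp_tpi1 _))/(Etrans _ (Esym (crp_step _))).
apply: (@Etrans _ _ _ _ _ _ _ _ _ _
  (Phcomp (Pitp (crp a) (crp f) (crp g)) (Pvcomp (Ptpi1 U) (Phid K)))).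
  by apply: Ehcomp; [exact: crp_ccl | exact: Erefl].
apply: (Etrans (Eitp_pi1 _ _ _)); apply: Ehcomp; first exact: Erefl.
by apply: Evcomp; [exact: Erefl | apply/Esym/crp_ccl].
Qed.

Lemma itp_uniq (c : Cell W X Y (eitp U ** K)) :
  c <|> (tpi0 U </> Hid K) =~ f ->
  c <|> (tpi1 U </> Hid K) =~ g <|> (a </> c) -> c = itp a f g.
Proof.
move=> /crp_eq h0 /crp_eq h1; rewrite -[c]crpK; apply/cclP.
apply: Eitp_uniq; first exact: Etrans (Esym (crp_tpi0 _)) h0.
exact: Etrans (Etrans (Esym (crp_tpi1 _)) h1) (crp_step _).
Qed.
End Itp.

Section Its.
Variables (U : AV) (X : A0) (V K : AV) (Y : A0) (W : AV).
Variables (a : Cell U X X V) (f : Cell K X Y W) (g : Cell (V ** W) mun mun W).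

Let crp_siota0 (c : Cell (eits U ** K) X Y W) :
  peq (crp ((siota0 U </> Hid K) <|> c))
    (Phcomp (Pvcomp (Psiota0 U) (Phid K)) (crp c)).
Proof.
apply: (Etrans (crp_hcomp _ _)); apply: Ehcomp; last exact: Erefl.
by apply: (Etrans (crp_vcomp _ _)); apply: Evcomp; apply: crp_ccl.
Qed.

Let crp_siota1 (c : Cell (eits U ** K) X Y W) :
  peq (crp ((siota1 U </> Hid K) <|> c))
    (Phcomp (Pvcomp (Psiota1 U) (Phid K)) (crp c)).
Proof.
apply: (Etrans (crp_hcomp _ _)); apply: Ehcomp; last exact: Erefl.
by apply: (Etrans (crp_vcomp _ _)); apply: Evcomp; apply: crp_ccl.
Qed.

Let crp_step (c : Cell (eits U ** K) X Y W) :
  peq (crp ((a </> c) <|> g)) (Phcomp (Pvcomp (crp a) (crp c)) (crp g)).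
Proof.
apply: (Etrans (crp_hcomp _ _)); apply: Ehcomp; last exact: Erefl.
exact: crp_vcomp.
Qed.

Lemma its_iota0 : (siota0 U </> Hid K) <|> its a f g =~ f.
Proof.
apply/eq_crp/(Etrans (crp_siota0 _)).
apply: (Etrans _ (Eits_iota0 (crp a) (crp f) (crp g))).
by apply: Ehcomp; [exact: Erefl | exact: crp_ccl].
Qed.

Lemma its_iota1 :
  (siota1 U </> Hid K) <|> its a f g =~ (a </> its a f g) <|> g.
Proof.
apply/eq_crp/(Etrans (crp_siota1 _))/(Etrans _ (Esym (crp_step _))).
apply: (@Etrans _ _ _ _ _ _ _ _ _ _
  (Phcomp (Pvcomp (Psiota1 U) (Phid K)) (Pits (crp a) (crp f) (crp g)))).
  by apply: Ehcomp; [exact: Erefl | exact: crp_ccl].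
apply: (Etrans (Eits_iota1 _ _ _)); apply: Ehcomp; last exact: Erefl.
by apply: Evcomp; [exact: Erefl | apply/Esym/crp_ccl].
Qed.

Lemma its_uniq (c : Cell (eits U ** K) X Y W) :
  (siota0 U </> Hid K) <|> c =~ f ->
  (siota1 U </> Hid K) <|> c =~ (a </> c) <|> g -> c = its a f g.
Proof.
move=> /crp_eq h0 /crp_eq h1; rewrite -[c]crpK; apply/cclP.
apply: Eits_uniq; first exact: Etrans (Esym (crp_siota0 _)) h0.
exact: Etrans (Etrans (Esym (crp_siota1 _)) h1) (crp_step _).
Qed.
End Its.

Notation H := (Hsmc (cornering A)).

Lemma coiteratesE V U W K (a : Cell V mun mun U) (f : Cell W mun mun K)
    (g : Cell W mun mun (V ** W)) (h : Cell W mun mun (eitp U ** K)) :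
  @coiterates H (@eitp A) (@tpi0 A) (@tpi1 A) V U W K a f g h <-> h = itp a f g.
Proof.
split=> [[/hom_cell_eq/HcompP h0 /hom_cell_eq/HcompP2 h1]|->].
  exact: itp_uniq.
by split; apply: cell_hom_eq; [apply/HcompP/itp_pi0 | apply/HcompP2/itp_pi1].
Qed.

Lemma iteratesE U V K W (a : Cell U mun mun V) (f : Cell K mun mun W)
    (g : Cell (V ** W) mun mun W) (h : Cell (eits U ** K) mun mun W) :
  @coiterates (op_smc H) (@eits A) (@siota0 A) (@siota1 A) V U W K a f g h <->
  h = its a f g.
Proof.
split=> [[/hom_eq_opV/hom_cell_eq/HcompP h0]|->].
  by move=> /hom_eq_opV/hom_cell_eq/HcompP2 h1; apply: its_uniq.
split; apply/hom_eq_op/cell_hom_eq; first exact/HcompP/its_iota0.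
exact/HcompP2/its_iota1.
Qed.

Lemma cell_cast_itp U V W (a : Cell V mun mun U) (f : Cell W mun mun mun)
    (g : Cell W mun mun (V ** W)) (e : eitp U ** mun = eitp U) :
  let h := cell_cast erefl erefl erefl e (itp a f g) in
  Hcomp h (tpi0 U) = f /\ Hcomp h (tpi1 U) = Hcomp g (a </> h).
Proof.
split; apply/cell_eq_eq.
  apply/(@HcompP (cornering A)); apply: cell_eq_trans _ (itp_pi0 a f g).
  apply: (@hcomp_cell_eq (cornering A)); first exact: cell_cast_eq.
  exact: cell_eq_sym (@Hten1r (cornering A) _ _ _).
apply/(@HcompP2 (cornering A)); apply: (@cell_eq_trans _ _ _ _ _ _ _ _ _ _ _ _
  (itp a f g <|> (tpi1 U </> Hid mun))).
  apply: (@hcomp_cell_eq (cornering A)); first exact: cell_cast_eq.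
  exact: cell_eq_sym (@Hten1r (cornering A) _ _ _).
apply: (cell_eq_trans (itp_pi1 a f g));
  apply: (@hcomp_cell_eq (cornering A)); first exact: CellEq.
apply: (@vcomp_cell_eq (cornering A)); first exact: CellEq.
exact/cell_eq_sym/cell_cast_eq.
Qed.

Lemma cell_cast_its U V W (a : Cell U mun mun V) (f : Cell mun mun mun W)
    (g : Cell (V ** W) mun mun W) (e : eits U ** mun = eits U) :
  let h := cell_cast e erefl erefl erefl (its a f g) in
  Hcomp (siota0 U) h = f /\ Hcomp (siota1 U) h = Hcomp (a </> h) g.
Proof.
split; apply/cell_eq_eq.
  apply/(@HcompP (cornering A)); apply: cell_eq_trans _ (its_iota0 a f g).
  apply: (@hcomp_cell_eq (cornering A)); last exact: cell_cast_eq.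
  exact: cell_eq_sym (@Hten1r (cornering A) _ _ _).
apply/(@HcompP2 (cornering A)); apply: (@cell_eq_trans _ _ _ _ _ _ _ _ _ _ _ _
  ((siota1 U </> Hid mun) <|> its a f g)).
  apply: (@hcomp_cell_eq (cornering A)); last exact: cell_cast_eq.
  exact: cell_eq_sym (@Hten1r (cornering A) _ _ _).
apply: (cell_eq_trans (its_iota1 a f g));
  apply: (@hcomp_cell_eq (cornering A)); last exact: CellEq.
apply: (@vcomp_cell_eq (cornering A)); first exact: CellEq.
exact/cell_eq_sym/cell_cast_eq.
Qed.

Lemma timesm_tpi0 U W (a : Cell U mun mun W) :
  Hcomp (timesm a) (tpi0 W) = tpi0 U.
Proof.
rewrite (cell_cast_itp _ _ _ _).1; apply: cell_eq_eq.
by apply: (cell_eq_trans (cell_cast_eq _ _ _ _ _)); rewrite -hid_vid;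
  apply: (@hcomp_idr (cornering A)).
Qed.

Lemma plusm_siota0 U W (a : Cell U mun mun W) :
  Hcomp (siota0 U) (plusm a) = siota0 W.
Proof.
rewrite (cell_cast_its _ _ _ _).1; apply: cell_eq_eq.
by apply: (cell_eq_trans (cell_cast_eq _ _ _ _ _)); rewrite -hid_vid;
  apply: (@hcomp_idl (cornering A)).
Qed.

Lemma Hcomp_eqm_r U V W (a : Cell U mun mun V) (e : V = W) :
  Hcomp a (@eqm H V W e) =~ a.
Proof. by case: W / e; rewrite (@Hcomp_idr (cornering A)); apply: CellEq. Qed.

Lemma Hcomp_eqm_l U V W (a : Cell V mun mun W) (e : U = V) :
  Hcomp (@eqm H U V e) a =~ a.
Proof.
by case: V / e a => a; rewrite (@Hcomp_idl (cornering A)); apply: CellEq.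
Qed.

Lemma epsilonE U :
  epsilon U = Hcomp (Hcomp (tpi1 U) (Hid U </> tpi0 U)) (@run H U).
Proof.
apply: cell_eq_eq; apply: (cell_eq_trans (cell_cast_eq _ _ _ _ _)).
apply: cell_eq_sym; apply: (cell_eq_trans (Hcomp_eqm_r _ _)).
exact: (@HcompE (cornering A)).
Qed.

Lemma etaE U :
  eta U = Hcomp (@run (op_smc H) U) (Hcomp (Hid U </> siota0 U) (siota1 U)).
Proof.
rewrite /run eqm_op.
apply: cell_eq_eq; apply: (cell_eq_trans (cell_cast_eq _ _ _ _ _)).
apply: cell_eq_sym; apply: (cell_eq_trans (Hcomp_eqm_l _ _)).
exact: (@HcompE (cornering A)).
Qed.
End Iteration.

Theorem lemma19 (A : distMonCat) :
  @is_comonad (Hcat (cornering A)) (@eitp A)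
    (fun U W => @timesm A mun U W) (@epsilon A) (@delta A) /\
  @is_monad (Hcat (cornering A)) (@eits A)
    (fun U W => @plusm A mun U W) (@eta A) (@mu A).
Proof.
split.
  apply: (@coiteration_comonad (Hsmc (cornering A)) _ (@tpi0 A) (@tpi1 A) _
     _ (@Delta A)).
  - by move=> V U W K a f g h h' /coiteratesE -> /coiteratesE ->.
  - exact: timesm_tpi0.
  - by move=> U W a; apply: (cell_cast_itp _ _ _ _).2.
  - by move=> U; apply/coiteratesE.
  - exact: epsilonE.
  - by move=> U; apply: (cell_cast_itp _ _ _ _).1.
  - by move=> U; apply: (cell_cast_itp _ _ _ _).2.
apply: comonad_op.
apply: (@coiteration_comonad (op_smc (Hsmc (cornering A))) _ (@siota0 A)
  (@siota1 A) _ _ (@Nabla A)).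
- by move=> V U W K a f g h h' /iteratesE -> /iteratesE ->.
- by move=> U W a; apply: plusm_siota0.
- by move=> U W a; apply: (cell_cast_its _ _ _ _).2.
- by move=> U; apply/iteratesE.
- exact: etaE.
- by move=> U; apply: (cell_cast_its _ _ _ _).1.
- by move=> U; apply: (cell_cast_its _ _ _ _).2.
Qed.
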